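(* Let $x^{(0)}\in\mathcal{X}$, $u^{(0)}\in\mathcal{U}$, $v^{(0)}\in\mathcal{V}$. Let $\tau>0$, $\sigma>0$, $\eta>0$ be such that $\tau\sigma\|L\|^2<1$ and $\tau\eta\|K\|^2<1$. Let $(\rho^{(i)})_{i\in\mathbb{N}}$ be a sequence in $[0,2]$ such that $\sum_{i\in\mathbb{N}}\rho^{(i)}(2-\rho^{(i)})=+\infty$. Consider the iteration, for $i=0,1,\ldots$, $$\begin{aligned}v^{(i+\frac12)}&=\mathrm{prox}_{\eta f^*}\Big(v^{(i)}+\eta K\big(x^{(i)}-\tau(L^*u^{(i)}+K^*v^{(i)}+c)\big)\Big),\\ x^{(i+\frac12)}&=x^{(i)}-\tau\big(L^*u^{(i)}+K^*v^{(i+\frac12)}+c\big),\\ u^{(i+\frac12)}&=\mathrm{prox}_{\sigma g^*}\big(u^{(i)}+\sigma L(2x^{(i+\frac12)}-x^{(i)})\big),\\ x^{(i+1)}&=x^{(i)}+\rho^{(i)}(x^{(i+\frac12)}-x^{(i)}),\\ u^{(i+1)}&=u^{(i)}+\rho^{(i)}(u^{(i+\frac12)}-u^{(i)}),\\ v^{(i+1)}&=v^{(i)}+\rho^{(i)}(v^{(i+\frac12)}-v^{(i)}).\end{aligned}$$ Then $(x^{(i)})_{i\in\mathbb{N}}$ converges weakly to a solution of the primal problem of minimizing $f(Kx)+g(Lx)+\langle x,c\rangle$ over $x\in\mathcal{X}$, and $\big((u^{(i)},v^{(i)})\big)_{i\in\mathbb{N}}$ converges weakly to a solution of the dual problem of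 minimizing $f^*(v)+g^*(u)$ over $(u,v)\in\mathcal{U}\times\mathcal{V}$ subject to $K^*v+L^*u+c=0$.
   Context: $\mathcal{X},\mathcal{U},\mathcal{V}$ are real Hilbert spaces. For a real Hilbert space $\mathcal{H}$, $\Gamma_0(\mathcal{H})$ is the set of convex, proper, lower semicontinuous functions from $\mathcal{H}$ to $\mathbb{R}\cup\{+\infty\}$; for $\varphi\in\Gamma_0(\mathcal{H})$, $\varphi^*(y)=\sup_{x\in\mathcal{H}}(\langle x,y\rangle-\varphi(x))$ is its conjugate, $\partial\varphi$ its subdifferential, and $\mathrm{prox}_{\varphi}(x)=\operatorname{arg\,min}_{x'\in\mathcal{H}}(\varphi(x')+\frac12\|x'-x\|^2)$. Here $f\in\Gamma_0(\mathcal{V})$, $g\in\Gamma_0(\mathcal{U})$, $c\in\mathcal{X}$, and $K:\mathcal{X}\to\mathcal{V}$, $L:\mathcal{X}\to\mathcal{U}$ are nonzero bounded linear operators with adjoints $K^*,L^*$. Standing assumption: there exists $x\in\mathcal{X}$ with $0\in K^*\partial f(Kx)+L^*\partial g(Lx)+c$. *)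

(* Defs.v *)
From HB Require Import structures.
From mathcomp Require Import all_boot all_order all_algebra.
From mathcomp Require Import sesquilinear.
From mathcomp Require Import all_classical all_reals all_analysis.

Set Implicit Arguments.
Unset Strict Implicit.
Unset Printing Implicit Defensive.

Import Order.TTheory GRing.Theory Num.Theory.
Import numFieldNormedType.Exports.

Local Open Scope classical_set_scope.
Local Open Scope ring_scope.

(* A real Hilbert space is a complete normed module whose norm is induced by a
   symmetric, positive definite bilinear form. *)
HB.mixin Record CompleteNormedModule_isHilbert (R : realType) (H : Type)
    & CompleteNormedModule R H := {
  inner : {dot H for (idfun : R -> R)} ;
  inner_norm : forall x : H, inner x x = `|x| ^+ 2
}.

#[short(type="hilbertType")]
HB.structure Definition Hilbert (R : realType) :=
  { H of CompleteNormedModule R H & CompleteNormedModule_isHilbert R H }.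

Section WeakConvergence.
Context {R : realType} {E : normedModType R}.

(* Convergence in the weak topology, the one induced by the topological dual.
   It depends on the norm only up to equivalence, so that on a product of two
   Hilbert spaces the sup norm of the library gives the same notion as the
   Hilbert norm. *)
Definition weakly_converges (s : nat -> E) (l : E) : Prop :=
  forall phi : {linear E -> R^o}, continuous phi ->
    phi (s n) @[n --> \oo] --> phi l.

End WeakConvergence.

Section Operators.
Context {R : realType}.

Definition opnorm (X Y : normedModType R) (A : {linear X -> Y}) : R :=
  sup [set `|A x| | x in [set x : X | `|x| <= 1]].

(* By the Riesz representation theorem, for a bounded A the set below is a
   singleton, so that [get] selects the value of the adjoint. *)
Definition adjoint (X Y : hilbertType R) (A : {linear X -> Y}) (y : Y) : X :=
  get [set z : X | forall x : X, inner (A x) y = inner x z].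

End Operators.

Section ConvexAnalysis.
Context {R : realType} {H : hilbertType R}.
Implicit Types phi : H -> \bar R.

Local Open Scope ereal_scope.

(* At t = 0 and t = 1 the inequality is an equality even for infinite values,
   since 0 * +oo = 0 in \bar R; the value -oo is excluded by [proper]. *)
Definition convex_efun phi : Prop :=
  forall (x y : H) (t : R), (0 <= t <= 1)%R ->
    phi (t *: x + (1 - t) *: y)%R <= t%:E * phi x + (1 - t)%R%:E * phi y.

Definition proper phi : Prop :=
  (forall x, phi x != -oo) /\ (exists x, phi x < +oo).

Definition Gamma0 : set (H -> \bar R) :=
  [set phi | [/\ convex_efun phi, proper phi & lower_semicontinuous phi]].

Definition conjugate phi (y : H) : \bar R :=
  ereal_sup [set (inner x y)%:E - phi x | x in [set: H]].

Definition subdifferential phi (x : H) : set H :=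
  [set p | forall y : H, phi x + (inner (y - x)%R p)%:E <= phi y].

End ConvexAnalysis.

Section Minimization.
Context {R : realType}.
Local Open Scope ereal_scope.

Definition argmin (T : Type) (A : set T) (F : T -> \bar R) : set T :=
  [set x | A x /\ forall y, A y -> F x <= F y].

(* For phi in Gamma0 the set of minimizers is a singleton. *)
Definition prox (H : hilbertType R) (phi : H -> \bar R) (x : H) : H :=
  get (argmin [set: H]
         (fun x' => phi x' + (2^-1 * `|x' - x| ^+ 2)%R%:E)).

End Minimization.

(* Main.v *)
Require Import Defs.
From HB Require Import structures.
From mathcomp Require Import all_boot all_order all_algebra.
From mathcomp Require Import sesquilinear.
From mathcomp Require Import all_classical all_reals all_analysis.
From mathcomp Require Import ring lra.

(** The algorithm is a relaxed proximal point iteration. Write z = (x, u, v) and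
    let A be the monotone operator
      A z = (K^* v + L^* u + c, dg^*(u) - L x, df^*(v) - K x),
    whose zeros are the triples satisfying the optimality conditions ([saddle]).
    One unrelaxed step z' of the algorithm satisfies P (z - z') \in A z', where
    P is the self-adjoint operator of the bilinear form [metric]:
      <P z, z> = |x|^2 / tau - 2 <L x, u> + |u|^2 / sigma
                 + |v|^2 / eta - tau |K^* v|^2.
    The bounds tau sigma |L|^2 < 1 and tau eta |K|^2 < 1 make this form coercive
    ([metric_equivalent]), so the step is the resolvent of a monotone operator
    for an equivalent inner product, hence firmly nonexpansive
    ([pd_step_firm]), and its fixed points are the saddle triples.

    Weak convergence of such an iteration is the Krasnoselskii-Mann theorem,
    proved here for any form equivalent to the norm ([Krasnoselskii_Mann]).
    The distances to fixed points decrease, and the decrease bounds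
    sum_i rho_i (2 - rho_i) |T z_i - z_i|^2. Since the residual
    |T z_i - z_i| is nonincreasing and the weights have an infinite sum, the
    residual tends to 0, even though rho_i (2 - rho_i) may come arbitrarily
    close to 0. Instead of weakly convergent subsequences, the proof takes weak
    limits along the ultrafilters finer than [\oo], which exist because bounded
    sequences of reals converge along ultrafilters. Each such limit is a fixed
    point, two such limits coincide by Opial's argument, and a sequence having
    the same limit along all these ultrafilters converges.

    On the Hilbert side everything rests on one existence result: when
    h + s/2 |. - b|^2 is bounded below, it has a minimizer p, and
    s (b - p) is then a subgradient of h at p ([resolvent_exists]). With h a
    linear functional it gives the Riesz representation theorem ([Riesz]).
    With h = f or h = g, for which the qualification condition provides a
    subgradient, hence a lower bound, it gives Moreau's decomposition
    ([prox_conjugateP]): w = prox_{s h^*} z is a subgradient of h at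
    (z - w) / s. Being stated through the subgradients of h, it turns fixed
    points directly into the primal optimality conditions; the dual ones follow
    since a subgradient q of h at y always makes y a subgradient of h^* at q
    ([subdifferential_conjugate]). *)

Set Implicit Arguments.
Unset Strict Implicit.
Unset Printing Implicit Defensive.

Import Order.TTheory GRing.Theory Num.Theory.
Import numFieldNormedType.Exports.

Local Open Scope classical_set_scope.
Local Open Scope ring_scope.

(** * Inner product *)

Section InnerProduct.
Context {R : realType} {H : hilbertType R}.
Implicit Types (x y z : H) (a : R).

Lemma innerC x y : inner x y = inner y x.
Proof. by rewrite hermC/= expr0 mul1r. Qed.

Lemma innerDl x y z : inner (x + y) z = inner x z + inner y z.
Proof. exact: linearDl. Qed.

Lemma innerDr x y z : inner x (y + z) = inner x y + inner x z.
Proof. exact: linearDr. Qed.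

Lemma innerNl x y : inner (- x) y = - inner x y.
Proof. exact: linearNl. Qed.

Lemma innerNr x y : inner x (- y) = - inner x y.
Proof. exact: linearNr. Qed.

Lemma innerZl a x y : inner (a *: x) y = a * inner x y.
Proof. exact: linearZl_LR. Qed.

Lemma innerZr a x y : inner x (a *: y) = a * inner x y.
Proof. exact: linearZr_LR. Qed.

Lemma inner0l x : inner 0 x = 0.
Proof. exact: linear0l. Qed.

Lemma inner0r x : inner x 0 = 0.
Proof. exact: linear0r. Qed.

Definition innerE :=
  (innerDl, innerDr, innerNl, innerNr, innerZl, innerZr, inner0l, inner0r).

Lemma inner_ge0 x : 0 <= inner x x.
Proof. by rewrite inner_norm sqr_ge0. Qed.

Lemma inner_eq0 x : inner x x = 0 -> x = 0.
Proof. by rewrite inner_norm => /eqP; rewrite sqrf_eq0 normr_eq0 => /eqP. Qed.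

Lemma dist_sqr_le0 x y : `|x - y| ^+ 2 <= 0 -> x = y.
Proof.
move=> xy; apply/eqP; rewrite -subr_eq0 -normr_eq0 -sqrf_eq0.
by rewrite eq_le xy sqr_ge0.
Qed.

(** Testing against all vectors reduces identities between vectors to
    identities between reals, where [ring] applies. *)
Lemma inner_inj x y : (forall z, inner z x = inner z y) -> x = y.
Proof.
move=> xy; apply/eqP; rewrite -subr_eq0; apply/eqP/inner_eq0.
by rewrite innerDr innerNr xy subrr.
Qed.

Lemma Cauchy_Schwarz x y : `|inner x y| <= `|x| * `|y|.
Proof.
have [->|x0] := eqVneq x 0; first by rewrite inner0l !normr0 mul0r.
have xx0 : 0 < `|x| ^+ 2 by rewrite exprn_gt0// normr_gt0.
rewrite -ler_sqr ?nnegrE ?mulr_ge0// exprMn real_normK ?num_real//.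
have := inner_ge0 (`|x| ^+ 2 *: y - inner x y *: x).
rewrite !innerE (innerC y x) !inner_norm => h.
rewrite -subr_ge0 -(pmulr_rge0 _ xx0); apply: le_trans h _.
by rewrite le_eqVlt; apply/orP; left; apply/eqP; ring.
Qed.

End InnerProduct.

(** * Minimization and subgradients *)

Section Minty.
Context {R : realType} {H : hilbertType R}.
Implicit Types (h : H -> \bar R).

Lemma proper_le_fin h x r :
  Defs.proper h -> (h x <= r%:E)%E -> h x \is a fin_num.
Proof. by move=> [hN _]; have := hN x; case: (h x). Qed.

Lemma subdifferential_fin_num h x p :
  Defs.proper h -> subdifferential h x p -> h x \is a fin_num.
Proof.
move=> [hN [y hy]] /(_ y); have := hN x; have := hN y.
by case: (h x) => //; case: (h y) hy.
Qed.

Lemma subdifferential_monotone h x y p q : Defs.proper h ->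
  subdifferential h x p -> subdifferential h y q ->
  0 <= inner (x - y) (p - q).
Proof.
move=> ph hp hq; have hx := subdifferential_fin_num ph hp.
have hy := subdifferential_fin_num ph hq.
move: (hp y) (hq x); rewrite -(fineK hx) -(fineK hy) -!EFinD !lee_fin !innerE.
lra.
Qed.

(** At the midpoint of w n and w k the quadratic term is smaller than the
    average of its values by s/8 |w n - w k|^2 (parallelogram law), while h
    does not exceed its average; the lower bound m would be violated unless
    this gap is at most the average of r n - m and r k - m. *)
Lemma minimizing_sequence_cauchy h (s m : R) (b : H) (w : nat -> H)
    (r : nat -> R) :
  convex_efun h -> Defs.proper h -> 0 < s ->
  (forall y, (m%:E <= h y + (s / 2 * `|y - b| ^+ 2)%:E)%E) ->
  (forall n, h (w n) + (s / 2 * `|w n - b| ^+ 2)%:E = (r n)%:E)%E ->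
  r @ \oo --> m -> cvgn w.
Proof.
move=> hcvx hp s0 lbm wr rm.
have wfin n : h (w n) \is a fin_num.
  apply: (@proper_le_fin _ _ (r n)) => //; rewrite -wr leeDl// lee_fin.
  by rewrite mulr_ge0// ?sqr_ge0// divr_ge0// ltW.
have gap n k : s / 8 * `|w n - w k| ^+ 2 <= (r n - m) / 2 + (r k - m) / 2.
  have half01 : (0 <= 2^-1 :> R) && (2^-1 <= 1 :> R) by lra.
  have := hcvx (w n) (w k) _ half01.
  move: (wr n) (wr k) (lbm (2^-1 *: w n + (1 - 2^-1) *: w k)).
  rewrite -(fineK (wfin n)) -(fineK (wfin k)) -!EFinD => -[] rnE -[] rkE.
  set y := (_ + _ *: w k) => my hy.
  have := le_trans my (leeD2r _ hy); rewrite -EFinD lee_fin.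
  move: rnE rkE; rewrite /y -!inner_norm !innerE.
  rewrite (innerC (w k) (w n)) (innerC b) (innerC b).
  set h1 := fine _; set h2 := fine _; nra.
apply/cauchy_cvgP/cauchy_exP => e e0 /=.
have d0 : 0 < s / 8 * e ^+ 2 by rewrite mulr_gt0 ?exprn_gt0 ?divr_gt0.
have /cvgrPdist_lt/(_ _ d0) := rm.
move=> [N _ HN]; exists (w N); exists N => // n /= Nn.
rewrite -ball_normE /= -ltr_sqr ?nnegrE ?(ltW e0)//.
rewrite -(@ltr_pM2l _ (s / 8)) ?divr_gt0//; apply: le_lt_trans (gap N n) _.
have := HN N (leqnn N); have := HN n Nn => /=.
rewrite !(distrC m) => /ltr_normlW ? /ltr_normlW ?; lra.
Qed.

(** A minimizing sequence converges, and lower semicontinuity shows that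
    the value at its limit does not exceed the infimum. *)
Lemma minimizer_exists h (s M : R) (b : H) : Gamma0 h -> 0 < s ->
  (forall y, (M%:E <= h y + (s / 2 * `|y - b| ^+ 2)%:E)%E) ->
  exists p, h p \is a fin_num /\
    forall y, (h p + (s / 2 * `|p - b| ^+ 2)%:E <=
               h y + (s / 2 * `|y - b| ^+ 2)%:E)%E.
Proof.
move=> [hcvx hp hlsc] s0 lbM.
pose q y := s / 2 * `|y - b| ^+ 2.
have q0 y : 0 <= q y by rewrite /q mulr_ge0// ?sqr_ge0// divr_ge0// ltW.
pose E := [set r : R | exists y, (h y + (q y)%:E = r%:E)%E].
have E0 : E !=set0.
  have [hN [y hy]] := hp; exists (fine (h y) + q y), y.
  by move: (hN y) hy; case: (h y).
have Elb : has_lbound E.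
  by exists M => r [y yr]; rewrite -lee_fin -yr; exact: lbM.
have Einf : has_inf E by split.
pose m := inf E.
have lbm y : (m%:E <= h y + (q y)%:E)%E.
  have [hN _] := hp; have := hN y; case hyE : (h y) => [a| |] // _.
    by rewrite -EFinD lee_fin; apply: ge_inf => //; exists y; rewrite hyE.
  by rewrite addye ?leey.
have /choice[w /choice[r wr]] : forall n, exists w, exists r,
    (h w + (q w)%:E = r%:E)%E /\ m <= r <= m + n.+1%:R^-1.
  move=> n; have [|r [w wr] rm] := @inf_adherent _ E n.+1%:R^-1 _ Einf.
    by rewrite invr_gt0.
  exists w, r; split=> //; rewrite (ltW rm) andbT.
  by apply: ge_inf => //; exists w.
have rm : r @ \oo --> m.
  apply: (@squeeze_cvgr _ _ _ _ (cst m) (fun n => m + n.+1%:R^-1)).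
  - by near=> n; have [_] := wr n.
  - exact: cvg_cst.
  - rewrite -[X in _ --> X]addr0; apply: cvgD; first exact: cvg_cst.
    exact: cvg_harmonic.
have wE n := (wr n).1.
have wp := minimizing_sequence_cauchy hcvx hp s0 lbm wE rm.
pose p := lim (w @ \oo).
have qw : (q \o w) @ \oo --> q p.
  rewrite /q /=; apply: cvgM; first exact: cvg_cst.
  apply: cvgM; apply: cvg_norm; apply: cvgB => //; exact: cvg_cst.
have hpm : (h p <= (m - q p)%:E)%E.
  rewrite leNgt; apply/negP => lt_p.
  have [a /andP[ma ap]] : exists a, (m - q p < a) && (a%:E < h p)%E.
    move: lt_p; have := hp.1 p; case: (h p) => [d _| _ _|//].
      rewrite lte_fin => md; exists ((m - q p + d) / 2).
      by rewrite lte_fin; apply/andP; lra.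
    by exists (m - q p + 1); rewrite ltry andbT; lra.
  have [W Wp Wa] := hlsc _ _ ap.
  have wW : \forall n \near \oo, W (w n) by exact: wp.
  have : a <= m - q p.
    have cv : (r \- (q \o w)) @ \oo --> m - q p by exact: cvgB.
    apply: (cvgr_to_ge cv); apply: filterS wW => n /Wa; have := wE n => /=.
    by case: (h (w n)) => [d| |] //= [<-]; rewrite lte_fin => /ltW; lra.
  by rewrite leNgt ma.
exists p; split; first exact: proper_le_fin hp hpm.
by move=> y; apply: le_trans (lbm y); rewrite -leeBrDr// -EFinB.
Unshelve. all: by end_near.
Qed.

End Minty.

Section MintyRiesz.
Context {R : realType} {H : hilbertType R}.
Implicit Types (h : H -> \bar R).

(** The optimality condition of a minimizer p: compare p with the points
    t y + (1 - t) p and let t tend to 0. *)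
Lemma resolvent_exists h (s M : R) (b : H) : Gamma0 h -> 0 < s ->
  (forall y, (M%:E <= h y + (s / 2 * `|y - b| ^+ 2)%:E)%E) ->
  exists p, subdifferential h p (s *: (b - p)).
Proof.
move=> hG s0 /(minimizer_exists hG s0)[p [pfin pmin]].
exists p => y; have [hcvx [hN _] _] := hG.
have := hN y; case hyE : (h y) => [a| |] // _; last by rewrite leey.
rewrite -(fineK pfin) -EFinD lee_fin.
set d := `|y - p| ^+ 2.
have slope_le t : 0 < t <= 1 ->
    inner (y - p) (s *: (b - p)) <= a - fine (h p) + t * (s / 2 * d).
  move=> /andP[t0 t1].
  have t01 : 0 <= t <= 1 by rewrite (ltW t0).
  have := hcvx y p t t01; have := pmin (t *: y + (1 - t) *: p).
  rewrite hyE -(fineK pfin) -!EFinD.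
  set z := (_ + _ *: p) => zmin hz.
  have := le_trans zmin (leeD2r _ hz).
  rewrite -EFinD lee_fin -!inner_norm /z /d -inner_norm => le_tz.
  rewrite -(ler_pM2l t0); move: le_tz.
  rewrite !innerE (innerC p y) (innerC b y) (innerC b p); lra.
rewrite addrC -lerBrDr; apply/ler_addgt0Pl => e e0.
(* small enough for t (s / 2 * d) <= e; the added 1 covers the case d = 0 *)
pose t := Num.min 1 (e / (s / 2 * d + 1)).
have sd0 : 0 < s / 2 * d + 1.
  by rewrite ltr_wpDl// mulr_ge0 ?sqr_ge0// divr_ge0// ltW.
have t01 : 0 < t <= 1.
  by rewrite /t lt_min ltr01/= divr_gt0//= ge_min lexx.
apply: (le_trans (slope_le t t01)); rewrite addrC lerD2r.
have te : t * (s / 2 * d + 1) <= e.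
  by rewrite -ler_pdivlMr// /t ge_min lexx orbT.
by apply: le_trans te; rewrite ler_pM2l ?(andP t01).1// lerDl.
Qed.

(** A subgradient q provides an affine minorant of h; completing the square
    shows that the quadratic term dominates it. *)
Lemma resolvent_exists_of_subgradient h (s : R) (b y q : H) :
  Gamma0 h -> 0 < s -> subdifferential h y q ->
  exists p, subdifferential h p (s *: (b - p)).
Proof.
move=> hG s0 hq; have [_ hp _] := hG.
have hy := subdifferential_fin_num hp hq.
apply: (@resolvent_exists h s (fine (h y) + inner (b - y) q
                                - (2 * s)^-1 * inner q q)) => // z.
apply: le_trans (leeD2r _ (hq z)); rewrite -(fineK hy) -!EFinD lee_fin.
have := inner_ge0 (s *: (z - b) + q).
rewrite -subr_ge0 => sq.
rewrite -subr_ge0 -(pmulr_rge0 _ (_ : 0 < 2 * s)) ?mulr_gt0//.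
apply: (le_trans sq); rewrite le_eqVlt; apply/orP; left; apply/eqP.
rewrite -inner_norm !innerE (innerC q) (innerC q b) (innerC b z).
by field; rewrite gt_eqF.
Qed.

(** For h = - phi, a subgradient - p of h at p says that
    phi d <= <d, p> for all d, hence equality by linearity. The functional to
    minimize, |.|^2 / 2 - phi, is bounded below because phi is bounded. *)
Lemma Riesz (phi : {linear H -> R^o}) : continuous phi ->
  exists z, forall x, phi x = inner x z.
Proof.
move=> phi_cts; pose h x := (- phi x)%:E.
have /linear_boundedP/pinfty_ex_gt0[C C0 HC] : bounded_near phi (nbhs (0 : H)).
  by apply: continuous_linear_bounded; exact: phi_cts.
have hG : Gamma0 h.
  split.
  - move=> x y t _; rewrite /h linearD !linearZ /= -!EFinM -EFinD lee_fin.
    by rewrite !mulrN opprD.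
  - by split=> [x //|]; exists 0; rewrite ltry.
  - move=> x a; rewrite lte_fin => ax.
    exists [set y | a < - phi y]; last by move=> y; rewrite lte_fin.
    have : (fun y => - phi y) y @[y --> x] --> - phi x.
      by apply: cvgN; exact: phi_cts.
    by move/cvgr_gt => /(_ _ ax).
have [|p hp] := @resolvent_exists h 1 (- C ^+ 2 / 2) 0 hG ltr01.
  move=> y; rewrite /h -EFinD lee_fin subr0.
  have := HC y; have := sqr_ge0 (`|y| - C).
  move=> /= ? /ler_normlP[_ ?]; nra.
have le_phi d : phi d <= inner d p.
  have := hp (p + d); rewrite /h -EFinD lee_fin linearD addrAC subrr add0r.
  rewrite !innerE; lra.
exists p => x; apply/eqP; rewrite eq_le le_phi /=.
by have := le_phi (- x); rewrite innerNl linearN lerN2.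
Qed.

End MintyRiesz.

(** * Adjoint operators *)

Section Adjoint.
Context {R : realType} {X Y : hilbertType R} (A : {linear X -> Y}).
Hypothesis A_bounded : bounded_near A (nbhs (0 : X)).

Lemma adjointP x y : inner (A x) y = inner x (adjoint A y).
Proof.
pose phi := (fun x => inner (A x) y) : X -> R^o.
have phi_linear : linear phi.
  by move=> a x1 x2; rewrite /phi linearP !innerE.
pose philin := GRing.isLinear.Build _ _ _ _ phi phi_linear.
pose Phi : {linear X -> R^o} := HB.pack phi philin.
have [|z zP] := @Riesz R X Phi; last first.
  by rewrite /adjoint; case: xgetP => [_ -> ->//|/(_ z)[]]; exact: zP.
apply: bounded_linear_continuous; apply/linear_boundedP.
have /linear_boundedP/pinfty_ex_gt0[C C0 HC] := A_bounded.
near=> r => w /=; apply: (le_trans (Cauchy_Schwarz _ _)).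
apply: (@le_trans _ _ (C * `|w| * `|y|)); first by rewrite ler_wpM2r.
rewrite mulrAC ler_wpM2r//; near: r; exact: nbhs_pinfty_ge.
Unshelve. all: by end_near.
Qed.

Lemma adjointD y1 y2 : adjoint A (y1 + y2) = adjoint A y1 + adjoint A y2.
Proof. by apply: inner_inj => x; rewrite -adjointP !innerDr !adjointP. Qed.

Lemma adjointZ a y : adjoint A (a *: y) = a *: adjoint A y.
Proof. by apply: inner_inj => x; rewrite -adjointP !innerZr adjointP. Qed.

Lemma adjointN y : adjoint A (- y) = - adjoint A y.
Proof. by rewrite -scaleN1r adjointZ scaleN1r. Qed.

Lemma norm_le_opnorm x : `|A x| <= opnorm A * `|x|.
Proof.
have /linear_boundedP/pinfty_ex_gt0[C C0 HC] := A_bounded.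
have [->|x0] := eqVneq x 0; first by rewrite linear0 !normr0 mulr0.
have nx0 : 0 < `|x| by rewrite normr_gt0.
rewrite -ler_pdivrMr//; apply: ub_le_sup.
  exists C => _ [z /= z1 <-]; apply: (le_trans (HC z)).
  by rewrite ler_piMr// ltW.
exists (`|x|^-1 *: x) => /=.
  by rewrite normrZ normfV normr_id mulVf ?gt_eqF.
by rewrite linearZ normrZ normfV normr_id mulrC.
Qed.

Lemma opnorm_ge0 : 0 <= opnorm A.
Proof.
have /linear_boundedP/pinfty_ex_gt0[C C0 HC] := A_bounded.
apply: ub_le_sup; last by exists 0 => /=; rewrite ?normr0// linear0 normr0.
exists C => _ [z /= z1 <-]; apply: (le_trans (HC z)).
by rewrite ler_piMr// ltW.
Qed.

Lemma norm_adjoint_le y : `|adjoint A y| <= opnorm A * `|y|.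
Proof.
have [->|y0] := eqVneq (adjoint A y) 0.
  by rewrite normr0 mulr_ge0// opnorm_ge0.
have ny0 : 0 < `|adjoint A y| by rewrite normr_gt0.
rewrite -(ler_pM2l ny0) -expr2 -inner_norm -adjointP.
apply: (le_trans (ler_norm _)); apply: (le_trans (Cauchy_Schwarz _ _)).
rewrite mulrA (mulrC `|_| (opnorm A)); apply: ler_wpM2r => //.
exact: norm_le_opnorm.
Qed.

End Adjoint.

(** * Proximal operators of conjugates *)

Section ProxConjugate.
Context {R : realType} {H : hilbertType R} (h : H -> \bar R).
Hypothesis hG : Gamma0 h.

Lemma conjugate_ge (y w : H) : ((inner y w)%:E - h y <= conjugate h w)%E.
Proof. by apply: ereal_sup_ubound; exists y. Qed.

Lemma conjugate_subgradient (y q : H) : subdifferential h y q ->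
  conjugate h q = ((inner y q)%:E - h y)%E.
Proof.
move=> hq; have [_ hp _] := hG.
have hy := subdifferential_fin_num hp hq.
apply/eqP; rewrite eq_le conjugate_ge andbT; apply: ge_ereal_sup.
move=> _ [z _ <-]; have := hq z.
rewrite -(fineK hy) -EFinB; have := hp.1 z.
case: (h z) => [a| |] // _; last by rewrite addeC addNye leNye.
by rewrite -EFinD -EFinB !lee_fin !innerE; lra.
Qed.

Lemma subdifferential_conjugate (y q : H) :
  subdifferential h y q -> subdifferential (conjugate h) q y.
Proof.
move=> hq w; have [_ hp _] := hG; rewrite (conjugate_subgradient hq).
apply: le_trans (conjugate_ge y w).
rewrite -(fineK (subdifferential_fin_num hp hq)) -!EFinB -EFinD lee_fin.
rewrite !innerE !(innerC y); lra.
Qed.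

(** Moreau's decomposition. If p is the point such that
    w0 = s (z / s - p) is a subgradient of h at p, then p is a subgradient of
    h^* at w0 and z = w0 + s p, so that w0 is the minimizer that defines the
    proximal point, with quadratic growth; the selected minimizer is w0. The
    subgradient q of h at y bounds h from below, which makes p exist. *)
Lemma prox_conjugateP (s : R) (z y q : H) :
  0 < s -> subdifferential h y q ->
  let w := prox (fun q => (s%:E * conjugate h q)%E) z in
  subdifferential h (s^-1 *: (z - w)) w.
Proof.
move=> s0 hq w; have [_ hp _] := hG.
have [p hpw] := resolvent_exists_of_subgradient (s^-1 *: z) hG s0 hq.
set w0 := s *: _ in hpw.
have zp : z = w0 + s *: p.
  by rewrite /w0 scalerBr scalerA divff ?gt_eqF// scale1r subrK.
clearbody w0.
suff -> : w = w0 by rewrite {1}zp addrC addKr scalerA mulVf ?gt_eqF// scale1r.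
pose F q := (s%:E * conjugate h q + (2^-1 * `|q - z| ^+ 2)%:E)%E.
have hpf := subdifferential_fin_num hp hpw.
have F0 : F w0 \is a fin_num.
  by rewrite /F (conjugate_subgradient hpw) -(fineK hpf) -EFinB.
have Fmin v : (F w0 + (2^-1 * `|v - w0| ^+ 2)%:E <= F v)%E.
  have := subdifferential_conjugate hpw v.
  rewrite /F (conjugate_subgradient hpw) -(fineK hpf) -EFinB -!EFinM -!EFinD.
  case: (conjugate h v) => [a| |] // cv.
  - rewrite -EFinM -!EFinD lee_fin.
    rewrite lee_fin -(ler_pM2l s0) in cv; move: cv.
    rewrite -!inner_norm zp !innerE !(innerC w0 v).
    by rewrite !(innerC p); lra.
  - by rewrite gt0_muley ?lte_fin// addye//; exact: leey.
have : argmin [set: H] F w.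
  rewrite /w /prox; apply: xgetPex; exists w0; split=> // v _.
  by apply: le_trans (Fmin v); rewrite leeDl// lee_fin mulr_ge0// sqr_ge0.
move=> [_ /(_ w0 I)] /(le_trans (Fmin w)).
by rewrite -(fineK F0) -EFinD lee_fin gerDl pmulr_rle0// => /dist_sqr_le0.
Qed.

(** Monotonicity between the pairs (y, q) and (y + (q - w) / s, w), where w is
    the proximal point, reads - |w - q|^2 / s >= 0. *)
Lemma prox_conjugate_unique (s : R) (y q : H) :
  0 < s -> subdifferential h y q ->
  prox (fun q => (s%:E * conjugate h q)%E) (q + s *: y) = q.
Proof.
move=> s0 hq; have [_ hp _] := hG; set w := prox _ _.
have := subdifferential_monotone hp (prox_conjugateP (q + s *: y) s0 hq) hq.
rewrite -/w addrAC scalerDr scalerA mulVf ?gt_eqF// scale1r addrK.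
rewrite -opprB scalerN innerNl innerZl inner_norm oppr_ge0.
by rewrite pmulr_rle0 ?invr_gt0// => /dist_sqr_le0.
Qed.

End ProxConjugate.

(** * Weak limits along ultrafilters *)

Section WeakLimits.
Context {R : realType}.

Definition weak_limit (E : normedModType R) (F : set_system nat)
    (z : nat -> E) (l : E) : Prop :=
  forall phi : {linear E -> R^o}, continuous phi ->
    phi (z n) @[n --> F] --> phi l.

(** Weak compactness of the balls, in the form in which it is used here: it
    gives limits of sequences without extracting subsequences, and passes to
    products for free. *)
Definition weakly_ultracompact (E : normedModType R) : Prop :=
  forall (z : nat -> E) (M : R), (forall n, `|z n| <= M) ->
  forall F : set_system nat, UltraFilter F -> exists l, weak_limit F z l.

Lemma bounded_functional (E : normedModType R) (f : E -> R) (C : R) :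
  linear (f : E -> R^o) -> (forall x, `|f x| <= C * `|x|) ->
  exists2 phi : {linear E -> R^o}, continuous phi & phi =1 f.
Proof.
move=> f_linear f_bounded.
pose flin := GRing.isLinear.Build _ _ _ _ (f : E -> R^o) f_linear.
pose phi : {linear E -> R^o} := HB.pack (f : E -> R^o) flin.
exists phi => //; apply: bounded_linear_continuous; apply/linear_boundedP.
near=> r => x /=; apply: (le_trans (f_bounded x)).
rewrite ler_wpM2r//; near: r; apply: nbhs_pinfty_ge; exact: num_real.
Unshelve. all: by end_near.
Qed.

(** A filter is the intersection of the ultrafilters finer than it. *)
Lemma ultrafilter_near (T : Type) (F : set_system T) (A : set T) :
  ProperFilter F -> (forall G, UltraFilter G -> F `<=` G -> G A) -> F A.
Proof.
move=> FF FG; apply: contrapT => nFA.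
have WP : ProperFilter (within (~` A) F).
  apply: Build_ProperFilter_ex => B; rewrite /within/= => FB.
  apply: contrapT => /forallNP B0; apply: nFA.
  by apply: filterS FB => x ABx; apply: contrapT => /ABx /B0.
have [G [GU WG]] := ultraFilterLemma WP.
have GA : G A by apply: FG => // B FB; apply: WG; apply: filterS FB.
have GnA : G (~` A) by apply: WG; apply: (@filterE _ F).
have GP : ProperFilter G by exact: ultra_proper.
by have [x []] := filter_ex (filterI GA GnA).
Qed.

Lemma bounded_ultralimit (a : nat -> R) (M : R) (F : set_system nat) :
  UltraFilter F -> (forall n, `|a n| <= M) ->
  exists l : R, a n @[n --> F] --> l.
Proof.
move=> FU aM; have FP : ProperFilter F by exact: ultra_proper.
have [|l [_ al]] := @segment_compact R (- M) M (a @ F) _.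
  by apply: (@filterE _ F) => n /=; rewrite in_itv /= -ler_norml.
exists l => A Al.
have [//|FnA] := in_ultra_setVsetC (a @^-1` A) FU.
by have [x [/= ]] := al (~` A) A FnA Al.
Qed.

(** The limits of <z n, y> along the ultrafilter form a bounded linear
    functional of y, which the Riesz theorem represents by the weak limit. *)
Lemma hilbert_weakly_ultracompact (H : hilbertType R) :
  weakly_ultracompact H.
Proof.
move=> z M zM F FU; have FP : ProperFilter F by exact: ultra_proper.
have /choice[f fP] : forall y, exists l : R, inner (z n) y @[n --> F] --> l.
  move=> y; apply: (@bounded_ultralimit _ (M * `|y|)) => n.
  by apply: (le_trans (Cauchy_Schwarz _ _)); rewrite ler_wpM2r.
have [||phi phi_cts phiE] := @bounded_functional H f M.
- move=> a x y; apply: (cvg_unique _ (fP _)) => //=.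
  under eq_fun do rewrite innerDr innerZr.
  by apply: cvgD (fP y); apply: cvgMr; exact: fP.
- move=> x; apply: (cvgr_to_le (cvg_norm (fP x))); apply: nearW => n.
  by apply: (le_trans (Cauchy_Schwarz _ _)); rewrite ler_wpM2r.
have [l lP] := Riesz phi_cts.
exists l => psi /Riesz[y psiE]; rewrite psiE innerC -lP phiE.
under eq_fun do rewrite psiE; exact: fP.
Qed.

Lemma prod_weakly_ultracompact (E1 E2 : normedModType R) :
  weakly_ultracompact E1 -> weakly_ultracompact E2 ->
  weakly_ultracompact (E1 * E2)%type.
Proof.
move=> c1 c2 z M zM F FU; have FP : ProperFilter F by exact: ultra_proper.
have [|l1 l1P] := c1 (fst \o z) M _ F FU.
  by move=> n; apply: le_trans (zM n); rewrite prod_normE le_max lexx.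
have [|l2 l2P] := c2 (snd \o z) M _ F FU.
  by move=> n; apply: le_trans (zM n); rewrite prod_normE le_max lexx orbT.
exists (l1, l2) => phi phi_cts.
have /linear_boundedP/pinfty_ex_gt0[C C0 HC] :
    bounded_near phi (nbhs (0 : (E1 * E2)%type)).
  by apply: continuous_linear_bounded; exact: phi_cts.
have [||phi1 phi1_cts phi1E] :=
    @bounded_functional E1 (fun a => phi (a, 0)) C.
- move=> k x y; rewrite -linearP; congr (phi _).
  by rewrite [RHS]surjective_pairing /= scaler0 addr0.
- by move=> x; apply: (le_trans (HC _)); rewrite prod_normE normr0 max_l.
have [||phi2 phi2_cts phi2E] :=
    @bounded_functional E2 (fun b => phi (0, b)) C.
- move=> k x y; rewrite -linearP; congr (phi _).
  by rewrite [RHS]surjective_pairing /= scaler0 addr0.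
- by move=> x; apply: (le_trans (HC _)); rewrite prod_normE normr0 max_r.
have phiE a b : phi (a, b) = phi1 a + phi2 b.
  rewrite phi1E phi2E -linearD; congr (phi _).
  by rewrite [RHS]surjective_pairing /= addr0 add0r.
rewrite phiE (_ : (fun n => _) = fun n => phi1 (z n).1 + phi2 (z n).2).
  by apply: cvgD; [exact: l1P|exact: l2P].
by apply/funext => n; rewrite -phiE -surjective_pairing.
Qed.

End WeakLimits.

(** * The Krasnoselskii-Mann theorem *)

Section KrasnoselskiiMann.
Context {R : realType} {E : normedModType R}.

(** An inner product whose norm is equivalent to that of E. Keeping it separate
    from the norm allows E to be a product of Hilbert spaces with the sup norm,
    and the iteration to use a preconditioned metric. *)
Record equivalent_inner (B : E -> E -> R) : Prop := EquivalentInner {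
  eqinner_linear : forall w, linear (B^~ w : E -> R^o) ;
  eqinnerC : forall x y, B x y = B y x ;
  eqinner_bounded : exists C, forall x y, `|B x y| <= C * `|x| * `|y| ;
  eqinner_coercive : exists2 a, 0 < a & forall x, a * `|x| ^+ 2 <= B x x
}.

(** In terms of N = 2 T - id, this says that N is nonexpansive for B. *)
Definition firmly_nonexpansive (B : E -> E -> R) (T : E -> E) : Prop :=
  forall z w, 0 <= B ((z - T z) - (w - T w)) (T z - T w).

Variable (B : E -> E -> R).
Hypothesis HB : equivalent_inner B.

Lemma eqinnerDl x y w : B (x + y) w = B x w + B y w.
Proof. by have := eqinner_linear HB w 1 x y; rewrite !scale1r. Qed.

Lemma eqinner0l w : B 0 w = 0.
Proof. by apply: (@addIr _ (B 0 w)); rewrite -eqinnerDl !add0r. Qed.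

Lemma eqinnerZl a x w : B (a *: x) w = a * B x w.
Proof. by rewrite -[a *: x]addr0 (eqinner_linear HB) eqinner0l addr0. Qed.

Lemma eqinnerNl x w : B (- x) w = - B x w.
Proof. by rewrite -scaleN1r eqinnerZl mulN1r. Qed.

Lemma eqinnerDr x y w : B w (x + y) = B w x + B w y.
Proof. by rewrite eqinnerC// eqinnerDl !(eqinnerC HB w). Qed.

Lemma eqinnerZr a x w : B w (a *: x) = a * B w x.
Proof. by rewrite eqinnerC// eqinnerZl (eqinnerC HB w). Qed.

Lemma eqinnerNr x w : B w (- x) = - B w x.
Proof. by rewrite eqinnerC// eqinnerNl (eqinnerC HB w). Qed.

Definition eqinnerE :=
  (eqinnerDl, eqinnerDr, eqinnerNl, eqinnerNr, eqinnerZl, eqinnerZr).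

Lemma eqinner_ge0 x : 0 <= B x x.
Proof.
have [a a0 /(_ x)] := eqinner_coercive HB; apply: le_trans.
by rewrite mulr_ge0 ?sqr_ge0// ltW.
Qed.

Lemma eqinner_le0 x : B x x <= 0 -> x = 0.
Proof.
have [a a0 /(_ x) ax xx] := eqinner_coercive HB.
have := le_trans ax xx; rewrite pmulr_rle0// => sq.
by apply/eqP; rewrite -normr_eq0 -sqrf_eq0 eq_le sq sqr_ge0.
Qed.

Lemma weak_limit_eqinner F (z : nat -> E) l w :
  weak_limit F z l -> B (z n) w @[n --> F] --> B l w.
Proof.
move=> zl; have [C BC] := eqinner_bounded HB.
have [|phi phi_cts phiE] :=
  @bounded_functional R E (B^~ w) (C * `|w|) (eqinner_linear HB w).
  by move=> x; rewrite mulrAC.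
by rewrite -phiE; under eq_fun do rewrite -phiE; exact: zl.
Qed.

Variable T : E -> E.
Hypothesis T_firm : firmly_nonexpansive B T.
Variables (rho : nat -> R) (z : nat -> E).
Hypothesis rho_02 : forall i, 0 <= rho i <= 2.
Hypothesis rho_sum : (\sum_(0 <= i <oo) (rho i * (2 - rho i))%:E = +oo)%E.
Hypothesis zS : forall i, z i.+1 = z i + rho i *: (T (z i) - z i).

Let d i := T (z i) - z i.
Let delta i := B (d i) (d i).

(** Firm nonexpansiveness at z n and p gives
    B (d n) (z n - p) <= - delta n; the rest is the expansion of the square of
    (z n - p) + rho n d n. *)
Lemma fejer_decrease p n : T p = p ->
  B (z n.+1 - p) (z n.+1 - p) + rho n * (2 - rho n) * delta n
  <= B (z n - p) (z n - p).
Proof.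
move=> Tp; have /andP[r0 r2] := rho_02 n.
have := T_firm (z n) p; rewrite Tp subrr subr0 -opprB -/(d n).
have -> : T (z n) - p = d n + (z n - p) by rewrite /d addrA subrK.
have -> : z n.+1 - p = (z n - p) + rho n *: d n by rewrite zS addrAC.
move: (z n - p) => e; rewrite /delta.
move: (d n) => dn; rewrite !eqinnerE (eqinnerC HB e dn) => h.
have := mulr_ge0 r0 h; lra.
Qed.

(** With e = d n.+1 - d n, firm nonexpansiveness at z n.+1 and z n reads
    |e|^2 + rho n B e (d n) <= 0, and the variation of the residual is
    |e|^2 + 2 B e (d n), which is nonpositive as rho n <= 2. When rho n = 0,
    the first inequality forces e = 0. *)
Lemma residual_nonincreasing n : delta n.+1 <= delta n.
Proof.
have /andP[r0 r2] := rho_02 n.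
have := T_firm (z n.+1) (z n).
have zT k : z k - T (z k) = - d k by rewrite opprB.
have -> : T (z n.+1) - T (z n) = d n.+1 - d n + rho n *: d n.
  have Tz k : T (z k) = d k + z k by rewrite subrK.
  rewrite !Tz {1}zS -/(d n) opprD addrACA; congr (_ + _).
  by rewrite addrAC subrr add0r.
rewrite !zT /delta; move: (d n) (d n.+1) => d0 d1.
rewrite !eqinnerE (eqinnerC HB d0 d1) => h.
have := eqinner_ge0 (d1 - d0); rewrite !eqinnerE (eqinnerC HB d0 d1) => ee.
have [r_le0|r_gt0] := leP (rho n) 0; last by rewrite -(ler_pM2l r_gt0); nra.
suff -> : d1 = d0 by [].
apply/eqP; rewrite -subr_eq0; apply/eqP/eqinner_le0.
have rho0 : rho n = 0 by apply/eqP; rewrite eq_le r_le0.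
by move: h; rewrite !eqinnerE (eqinnerC HB d0 d1) rho0; lra.
Qed.

Variable p0 : E.
Hypothesis Tp0 : T p0 = p0.

Lemma residual_sum n :
  \sum_(0 <= i < n) rho i * (2 - rho i) * delta i + B (z n - p0) (z n - p0)
  <= B (z 0%N - p0) (z 0%N - p0).
Proof.
elim: n => [|n IHn]; first by rewrite big_nil add0r.
rewrite big_nat_recr//=; apply: le_trans IHn.
by rewrite -addrA lerD2l addrC fejer_decrease.
Qed.

(** A positive lower bound on the residual would bound the sum of the weights
    rho i (2 - rho i). *)
Lemma residual_lt e : 0 < e -> exists n, delta n < e.
Proof.
move=> e0; apply: contrapT => /forallNP He.
have eD n : e <= delta n by rewrite leNgt; apply/negP/He.
have r0 i : 0 <= rho i * (2 - rho i).
  by have /andP[? ?] := rho_02 i; rewrite mulr_ge0// subr_ge0.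
have : (\sum_(0 <= i <oo) (rho i * (2 - rho i))%:E <=
    (B (z 0%N - p0) (z 0%N - p0) / e)%:E)%E.
  apply: lime_le; first by apply: is_cvg_nneseries => i _ _; rewrite lee_fin.
  apply: nearW => n; rewrite sumEFin lee_fin ler_pdivlMr// mulr_suml.
  apply: le_trans (residual_sum n); rewrite -[leLHS]addr0.
  apply: lerD (eqinner_ge0 _); apply: ler_sum => i _.
  exact: ler_wpM2l.
by rewrite rho_sum.
Qed.

Lemma residual_cvg0 : d n @[n --> \oo] --> 0.
Proof.
have [a a0 Ba] := eqinner_coercive HB.
apply/cvgrPdist_lt => e e0 /=.
have [N HN] := @residual_lt (a * e ^+ 2) (mulr_gt0 a0 (exprn_gt0 2 e0)).
exists N => // n /= Nn; rewrite sub0r normrN.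
rewrite -ltr_sqr ?nnegrE ?(ltW e0)// -(ltr_pM2l a0).
apply: le_lt_trans (Ba _) _; apply: le_lt_trans HN.
elim: n Nn => [|n IHn]; first by rewrite leqn0 => /eqP ->.
rewrite leq_eqVlt => /orP[/eqP <- //|]; rewrite ltnS => /IHn.
exact/le_trans/residual_nonincreasing.
Qed.

Lemma fejer_nonincreasing p : T p = p ->
  nonincreasing_seq (fun n => B (z n - p) (z n - p)).
Proof.
move=> Tp; apply/nonincreasing_seqP => n.
apply: le_trans (fejer_decrease n Tp); rewrite lerDl mulr_ge0 ?eqinner_ge0//.
by have /andP[? ?] := rho_02 n; rewrite mulr_ge0// subr_ge0.
Qed.

Lemma iterates_bounded : exists M, forall n, `|z n| <= M.
Proof.
have [a a0 Ba] := eqinner_coercive HB.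
set b := B (z 0%N - p0) (z 0%N - p0).
have b0 : 0 <= b by exact: eqinner_ge0.
exists (1 + b / a + `|p0|) => n.
have /= zb : B (z n - p0) (z n - p0) <= b by exact: (fejer_nonincreasing Tp0).
rewrite -[z n](subrK p0); apply: (le_trans (ler_normD _ _)).
rewrite lerD2r; have := le_trans (Ba (z n - p0)) zb.
rewrite mulrC -ler_pdivlMr// ; move: `|_| => r sq.
have [r1|r1] := leP r 1; last nra.
by apply: le_trans r1 _; rewrite lerDl divr_ge0// ltW.
Qed.

(** Demiclosedness. In the firm nonexpansiveness inequality at z n and l, the
    terms that contain the residual vanish in the limit, which leaves
    - B (l - T l) (l - T l) >= 0. *)
Lemma weak_limit_fixed (F : set_system nat) l : ProperFilter F ->
  \oo `<=` F -> weak_limit F z l -> T l = l.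
Proof.
move=> FP ooF zl; have [C BC] := eqinner_bounded HB.
have [M zM] := iterates_bounded.
move Ea : (l - T l) => a.
suff : B a a <= 0.
  by move/eqinner_le0/eqP; rewrite -Ea subr_eq0 => /eqP.
have dF : d n @[n --> F] --> 0 by move=> A /residual_cvg0; exact: ooF.
have ndF : `|d n| @[n --> F] --> (0 : R).
  by rewrite -(@normr0 _ E); apply: cvg_norm.
pose bound n := `|C| * `|d n| * (M + `|T l| + `|a| + `|d n|).
have boundF : bound n @[n --> F] --> `|C| * 0 * (M + `|T l| + `|a| + 0).
  apply: cvgM; first by apply: cvgM => //; exact: cvg_cst.
  by apply: cvgD => //; exact: cvg_cst.
have BF : B (z n) a - B (T l) a @[n --> F] --> B l a - B (T l) a.
  by apply: cvgB; [exact: weak_limit_eqinner|exact: cvg_cst].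
have : 0 <= `|C| * 0 * (M + `|T l| + `|a| + 0) - (B l a - B (T l) a).
  apply: (cvgr_to_ge (cvgB boundF BF)); apply: nearW => n.
  rewrite -[leRHS]/(bound n - (B (z n) a - B (T l) a)).
  have := T_firm (z n) l.
  have -> : z n - T (z n) = - d n by rewrite opprB.
  have -> : T (z n) - T l = (z n - T l) + d n.
    by rewrite [RHS]addrC /d addrA subrK.
  rewrite Ea /bound; move: (d n) (z n) (zM n) => dn zn zn_le.
  rewrite !eqinnerE => h.
  have N1 : `|zn - T l + a + dn| <= M + `|T l| + `|a| + `|dn|.
    apply: (le_trans (ler_normD _ _)); rewrite lerD2r.
    apply: (le_trans (ler_normD _ _)); rewrite lerD2r.
    by apply: (le_trans (ler_normB _ _)); rewrite lerD2r.
  have : `|B dn (zn - T l + a + dn)|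
      <= `|C| * `|dn| * (M + `|T l| + `|a| + `|dn|).
    apply: (le_trans (BC _ _)).
    apply: (@le_trans _ _ (`|C| * `|dn| * `|zn - T l + a + dn|)).
      by rewrite !ler_wpM2r// ler_norm.
    by rewrite ler_wpM2l// mulr_ge0.
  move=> /ler_normlP[+ _]; rewrite !eqinnerE.
  rewrite (eqinnerC HB a zn) (eqinnerC HB a (T l)) (eqinnerC HB a dn) in h.
  lra.
rewrite mulr0 mul0r sub0r oppr_ge0 -eqinnerNl -eqinnerDl Ea; exact.
Qed.

Hypothesis Ecompact : weakly_ultracompact E.

(** Opial's argument: the squared distances from z n to the fixed points l and k
    both converge, so B (z n) (l - k), which is an affine function of their
    difference, has a limit; this limit is both B l (l - k) and B k (l - k). *)
Lemma weak_limit_unique (F G : set_system nat) l k :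
  ProperFilter F -> ProperFilter G -> \oo `<=` F -> \oo `<=` G ->
  weak_limit F z l -> weak_limit G z k -> l = k.
Proof.
move=> FP GP ooF ooG zl zk.
have Tl := weak_limit_fixed FP ooF zl; have Tk := weak_limit_fixed GP ooG zk.
have cvgB2 p : T p = p -> cvgn (fun n => B (z n - p) (z n - p)).
  move=> Tp; apply: nonincreasing_is_cvgn; first exact: fejer_nonincreasing.
  by exists 0 => _ [n _ <-]; exact: eqinner_ge0.
have zlk : cvgn (fun n => B (z n) (l - k)).
  rewrite (_ : (fun n => _) = fun n => (B (z n - k) (z n - k)
      - B (z n - l) (z n - l)) / 2 + (B l l - B k k) / 2).
    apply: is_cvgD; last exact: is_cvg_cst.
    apply: is_cvgM; last exact: is_cvg_cst.
    by apply: is_cvgB; exact: cvgB2.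
  apply/funext => n; rewrite !eqinnerE.
  by rewrite (eqinnerC HB k (z n)) (eqinnerC HB l (z n)); field.
have lF : B l (l - k) = limn (fun n => B (z n) (l - k)).
  apply: (cvg_unique _ (weak_limit_eqinner (w := l - k) zl)) => //.
  by move=> A /zlk; exact: ooF.
have kG : B k (l - k) = limn (fun n => B (z n) (l - k)).
  apply: (cvg_unique _ (weak_limit_eqinner (w := l - k) zk)) => //.
  by move=> A /zlk; exact: ooG.
apply/eqP; rewrite -subr_eq0; apply/eqP/eqinner_le0.
by rewrite eqinnerDl eqinnerNl lF kG subrr.
Qed.

(** All ultrafilters finer than [\oo] give the same weak limit, so the whole
    sequence converges to it by [ultrafilter_near]. *)
Theorem Krasnoselskii_Mann : exists2 l, T l = l & weakly_converges z l.
Proof.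
have [M zM] := iterates_bounded.
have ultra G : UltraFilter G -> exists k, weak_limit G z k.
  exact: Ecompact zM G.
have [F [FU ooF]] := @ultraFilterLemma _ \oo _.
have FP : ProperFilter F by exact: ultra_proper.
have [l zl] := ultra F FU.
exists l; first exact: weak_limit_fixed zl.
move=> phi phi_cts; apply/cvgrPdist_lt => e e0.
apply: ultrafilter_near => G GU ooG.
have GP : ProperFilter G by exact: ultra_proper.
have [k zk] := ultra G GU.
rewrite (weak_limit_unique FP GP ooF ooG zl zk).
by have /cvgrPdist_lt/(_ _ e0) := zk phi phi_cts.
Qed.

End KrasnoselskiiMann.

(** * The primal-dual step as a resolvent *)

Section PrimalDual.
Context {R : realType} {X U V : hilbertType R}.
Variables (f : V -> \bar R) (g : U -> \bar R) (c : X).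
Variables (K : {linear X -> V}) (L : {linear X -> U}).
Hypotheses (f_Gamma0 : Gamma0 f) (g_Gamma0 : Gamma0 g).
Hypotheses (K_bounded : bounded_near K (nbhs (0 : X)))
  (L_bounded : bounded_near L (nbhs (0 : X))).
Variables (tau sigma eta : R).
Hypotheses (tau_gt0 : 0 < tau) (sigma_gt0 : 0 < sigma) (eta_gt0 : 0 < eta).

(** This is <P z, w>, where P is the preconditioner for which one unrelaxed step
    of the algorithm is the resolvent (P + A)^-1 P. *)
Definition metric (z w : X * U * V) : R :=
  tau^-1 * inner z.1.1 w.1.1 - inner (L z.1.1) w.1.2 - inner (L w.1.1) z.1.2
  + sigma^-1 * inner z.1.2 w.1.2
  + eta^-1 * inner z.2 w.2 - tau * inner (adjoint K z.2) (adjoint K w.2).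

Section MetricEquivalent.
Hypotheses (tau_sigma_L : tau * sigma * opnorm L ^+ 2 < 1)
  (tau_eta_K : tau * eta * opnorm K ^+ 2 < 1).

(** With r = 1 - k, the claim is that the form
    r |x|^2 / tau - 2 <L x, u> + r |u|^2 / sigma is nonnegative, which holds as
    soon as tau sigma |L|^2 <= r^2; the choice of k makes r the average of 1
    and tau sigma |L|^2, so its square is at least the latter. *)
Lemma coercive_xu (x : X) (u : U) (k : R) :
  k = (1 - tau * sigma * opnorm L ^+ 2) / 2 ->
  k / tau * `|x| ^+ 2 + k / sigma * `|u| ^+ 2 <=
  tau^-1 * inner x x - 2 * inner (L x) u + sigma^-1 * inner u u.
Proof.
move=> kE; have l0 := opnorm_ge0 L_bounded.
have Lxu : inner (L x) u <= opnorm L * `|x| * `|u|.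
  apply: (le_trans (ler_norm _)); apply: (le_trans (Cauchy_Schwarz _ _)).
  by rewrite ler_wpM2r// norm_le_opnorm.
rewrite !inner_norm; move: `|x| `|u| Lxu => a b Lxu.
rewrite -subr_ge0 -(pmulr_rge0 _ (mulr_gt0 tau_gt0 sigma_gt0)).
have q1 := tau_sigma_L; move: (opnorm L) => l in kE q1 Lxu l0 *.
pose r := 1 - k.
have q0 : 0 <= tau * sigma * l ^+ 2.
  by rewrite mulr_ge0 ?sqr_ge0// mulr_ge0// ltW.
have r0 : 0 < r by rewrite /r kE; lra.
have rq : tau * sigma * l ^+ 2 <= r ^+ 2.
  by rewrite /r kE; move: (tau * sigma * l ^+ 2) q0 q1 => q ? ?; nra.
apply: (@le_trans _ _
  (r * (sigma * a ^+ 2 + tau * b ^+ 2) - 2 * (tau * sigma) * (l * a * b))).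
  rewrite -(pmulr_rge0 _ (mulr_gt0 r0 sigma_gt0)).
  have -> : r * sigma * (r * (sigma * a ^+ 2 + tau * b ^+ 2)
                - 2 * (tau * sigma) * (l * a * b))
    = (r * sigma * a - l * tau * sigma * b) ^+ 2
      + tau * sigma * b ^+ 2 * (r ^+ 2 - tau * sigma * l ^+ 2) by ring.
  rewrite addr_ge0 ?sqr_ge0// mulr_ge0 ?subr_ge0//.
  by rewrite mulr_ge0 ?sqr_ge0// mulr_ge0// ltW.
have -> : tau * sigma * (tau^-1 * a ^+ 2 - 2 * inner (L x) u
      + sigma^-1 * b ^+ 2 - (k / tau * a ^+ 2 + k / sigma * b ^+ 2)) =
    r * (sigma * a ^+ 2 + tau * b ^+ 2)
    - 2 * (tau * sigma) * inner (L x) u.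
  by rewrite /r; field; rewrite !gt_eqF.
by rewrite lerD2l lerN2 ler_pM2l// mulr_gt0// mulr_gt0.
Qed.

Lemma coercive_v (v : V) :
  (1 - tau * eta * opnorm K ^+ 2) / eta * `|v| ^+ 2 <=
  eta^-1 * inner v v - tau * inner (adjoint K v) (adjoint K v).
Proof.
rewrite !inner_norm mulrAC mulrC mulrBl mul1r mulrBr lerD2l lerN2.
have -> : eta^-1 * (tau * eta * opnorm K ^+ 2 * `|v| ^+ 2)
    = tau * (opnorm K * `|v|) ^+ 2 by field; rewrite gt_eqF.
rewrite ler_pM2l// ler_sqr ?nnegrE ?mulr_ge0 ?opnorm_ge0//.
exact: norm_adjoint_le.
Qed.

Lemma norm_component (z : X * U * V) :
  [/\ `|z.1.1| <= `|z|, `|z.1.2| <= `|z| & `|z.2| <= `|z|].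
Proof. by rewrite !prod_normE !le_max !lexx !orbT. Qed.

Lemma metric_equivalent : equivalent_inner metric.
Proof.
split.
- move=> w a z1 z2; rewrite /metric /= !linearP/= !adjointD// !adjointZ//.
  by rewrite !innerE /GRing.scale/=; ring.
- move=> z w; rewrite /metric (innerC z.1.1) (innerC z.1.2) (innerC z.2).
  by rewrite (innerC (adjoint K z.2)); ring.
- exists (tau^-1 + opnorm L + opnorm L + sigma^-1 + eta^-1
          + tau * opnorm K ^+ 2) => z w.
  have [x1 u1 v1] := norm_component z; have [x2 u2 v2] := norm_component w.
  have L1 := norm_le_opnorm L_bounded z.1.1.
  have L2 := norm_le_opnorm L_bounded w.1.1.
  have K1 := norm_adjoint_le K_bounded z.2.
  have K2 := norm_adjoint_le K_bounded w.2.
  have IB (H : hilbertType R) (a b : R) (s t : H) : 0 <= a -> 0 <= b ->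
      `|s| <= a * `|z| -> `|t| <= b * `|w| ->
      `|inner s t| <= a * b * (`|z| * `|w|).
    move=> a0 b0 sz tw; apply: (le_trans (Cauchy_Schwarz _ _)).
    by rewrite mulrACA; apply: ler_pM.
  have l0 := opnorm_ge0 L_bounded; have k0 := opnorm_ge0 K_bounded.
  have Lz : `|L z.1.1| <= opnorm L * `|z|.
    by apply: (le_trans L1); rewrite ler_wpM2l.
  have Lw : `|L w.1.1| <= opnorm L * `|w|.
    by apply: (le_trans L2); rewrite ler_wpM2l.
  have Kz : `|adjoint K z.2| <= opnorm K * `|z|.
    by apply: (le_trans K1); rewrite ler_wpM2l.
  have Kw : `|adjoint K w.2| <= opnorm K * `|w|.
    by apply: (le_trans K2); rewrite ler_wpM2l.
  have le1 (a b : R) : a <= b -> a <= 1 * b by rewrite mul1r.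
  have B1 := IB _ _ _ _ _ ler01 ler01 (le1 _ _ x1) (le1 _ _ x2).
  have B2 := IB _ _ _ _ _ l0 ler01 Lz (le1 _ _ u2).
  have B3 := IB _ _ _ _ _ ler01 l0 (le1 _ _ u1) Lw.
  have B4 := IB _ _ _ _ _ ler01 ler01 (le1 _ _ u1) (le1 _ _ u2).
  have B5 := IB _ _ _ _ _ ler01 ler01 (le1 _ _ v1) (le1 _ _ v2).
  have B6 := IB _ _ _ _ _ k0 k0 Kz Kw.
  rewrite (innerC z.1.2) in B3.
  rewrite !mul1r ?mulr1 -?expr2 in B1 B2 B3 B4 B5 B6.
  have scale (s a b : R) : 0 < s -> `|a| <= b -> `|s * a| <= s * b.
    by move=> s0 ab; rewrite normrM gtr0_norm// ler_pM2l.
  rewrite /metric -mulrA !mulrDl -(mulrA tau).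
  apply: (le_trans (ler_normB _ _)); apply: lerD; last exact: scale.
  apply: (le_trans (ler_normD _ _)); apply: lerD; last first.
    by apply: scale; rewrite ?invr_gt0.
  apply: (le_trans (ler_normD _ _)); apply: lerD; last first.
    by apply: scale; rewrite ?invr_gt0.
  apply: (le_trans (ler_normB _ _)); apply: lerD => //.
  apply: (le_trans (ler_normB _ _)); apply: lerD => //.
  by apply: scale; rewrite ?invr_gt0.
- set q := 1 - tau * sigma * opnorm L ^+ 2.
  set q' := 1 - tau * eta * opnorm K ^+ 2.
  exists (Num.min (q / 2 / tau) (Num.min (q / 2 / sigma) (q' / eta))).
    by rewrite !lt_min !divr_gt0// subr_gt0.
  move=> z; apply: (@le_trans _ _ (q / 2 / tau * `|z.1.1| ^+ 2
      + q / 2 / sigma * `|z.1.2| ^+ 2 + q' / eta * `|z.2| ^+ 2)).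
    set a := Num.min _ _.
    have [a1 a2 a3] : [/\ a <= q / 2 / tau, a <= q / 2 / sigma & a <= q' / eta].
      by rewrite /a !ge_min !lexx !orbT.
    have a0 : 0 <= a by rewrite /a !le_min !divr_ge0// ?subr_ge0 ltW.
    apply: (@le_trans _ _ (a * `|z.1.1| ^+ 2 + a * `|z.1.2| ^+ 2
                            + a * `|z.2| ^+ 2)); last first.
      by rewrite !lerD// ler_wpM2r// sqr_ge0.
    rewrite -!mulrDr ler_wpM2l//.
    have := sqr_ge0 `|z.1.1|; have := sqr_ge0 `|z.1.2|; have := sqr_ge0 `|z.2|.
    rewrite prod_normE [`|z.1|]prod_normE.
    by case: (leP `|z.1.1| `|z.1.2|) => _;
      [case: (leP `|z.1.2| `|z.2|)|case: (leP `|z.1.1| `|z.2|)] => _; lra.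
  have := coercive_xu z.1.1 z.1.2 erefl; have := coercive_v z.2.
  rewrite /metric -/q -/q'; lra.
Qed.

End MetricEquivalent.

Hypotheses (f_sub : exists y p, subdifferential f y p)
  (g_sub : exists y p, subdifferential g y p).

Definition pd_dual_v (z : X * U * V) : V :=
  prox (fun y => (eta%:E * conjugate f y)%E)
    (z.2 + eta *: K (z.1.1 - tau *: (adjoint L z.1.2 + adjoint K z.2 + c))).

Definition pd_primal (z : X * U * V) : X :=
  z.1.1 - tau *: (adjoint L z.1.2 + adjoint K (pd_dual_v z) + c).

Definition pd_dual_u (z : X * U * V) : U :=
  prox (fun y => (sigma%:E * conjugate g y)%E)
    (z.1.2 + sigma *: L (2 *: pd_primal z - z.1.1)).

Definition pd_step (z : X * U * V) : X * U * V :=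
  (pd_primal z, pd_dual_u z, pd_dual_v z).

Let KE := (linearD K, linearN K, linearZ_LR K).
Let LE := (linearD L, linearN L, linearZ_LR L).
Let KaE := (adjointD K_bounded, adjointN K_bounded, adjointZ K_bounded).
Let LaE := (adjointD L_bounded, adjointN L_bounded, adjointZ L_bounded).

(** The inclusion P (z - z') \in A z' tested against z', for the linear part of
    the step. It is applied to the difference of two steps, in which c cancels
    and the points of evaluation of df and dg appear as first factors. *)
Lemma metric_resolvent (x : X) (u u' : U) (v v' : V) :
  let x' := x - tau *: (adjoint L u + adjoint K v') in
  metric ((x, u, v) - (x', u', v')) (x', u', v') =
  inner (eta^-1 *: (v + eta *: K (x - tau *: (adjoint L u + adjoint K v)) - v'))
    v' +
  inner (sigma^-1 *: (u + sigma *: L (2 *: x' - x) - u')) u'.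
Proof.
rewrite /metric /= !(innerE, KaE, LaE).
rewrite !(innerE, adjointP K_bounded, adjointP L_bounded, KaE, LaE).
rewrite (innerC (adjoint L u) x) (innerC (adjoint K v') x).
rewrite (innerC (adjoint K v') (adjoint L u)).
by field; rewrite !gt_eqF.
Qed.

(** The inequality is the sum of the monotonicity inequalities of df and dg at
    the points that Moreau's decomposition attaches to the two steps. *)
Lemma pd_step_firm : firmly_nonexpansive metric pd_step.
Proof.
move=> z w.
have [_ pf _] := f_Gamma0; have [_ pg _] := g_Gamma0.
have [yf [sf fp]] := f_sub; have [yg [sg gp]] := g_sub.
have fE y := prox_conjugateP f_Gamma0
  (y.2 + eta *: K (y.1.1 - tau *: (adjoint L y.1.2 + adjoint K y.2 + c)))
  eta_gt0 fp.
have gE y := prox_conjugateP g_Gamma0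
  (y.1.2 + sigma *: L (2 *: pd_primal y - y.1.1)) sigma_gt0 gp.
have := addr_ge0 (subdifferential_monotone pf (fE z) (fE w))
  (subdifferential_monotone pg (gE z) (gE w)).
rewrite -/(pd_dual_v z) -/(pd_dual_v w) -/(pd_dual_u z) -/(pd_dual_u w).
rewrite /pd_step; move: (pd_dual_u z) (pd_dual_u w) => u1 u2.
rewrite /pd_primal; move: (pd_dual_v z) (pd_dual_v w) => v1 v2.
case: z w => [[x u] v] [[y t] s] /=.
have := metric_resolvent (x - y) (u - t) (u1 - u2) (v - s) (v1 - v2).
set x' := _ - _ *: _ => mE.
have x'E : x - tau *: (adjoint L u + adjoint K v1 + c)
      - (y - tau *: (adjoint L t + adjoint K v2 + c)) = x'.
  by apply: inner_inj => a; rewrite /x' !(KaE, LaE) !innerE; ring.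
have -> : (x, u, v) - (x - tau *: (adjoint L u + adjoint K v1 + c), u1, v1)
    - ((y, t, s) - (y - tau *: (adjoint L t + adjoint K v2 + c), u2, v2))
    = (x - y, u - t, v - s) - (x', u1 - u2, v1 - v2).
  rewrite -x'E [LHS]surjective_pairing [(_ : X * U * V).1]surjective_pairing /=.
  rewrite [RHS]surjective_pairing [X in (X, _)]surjective_pairing /=.
  by congr (_, _, _); apply: inner_inj => a; rewrite !innerE; ring.
rewrite -[X in metric _ X]/(_ - _, u1 - u2, v1 - v2) x'E mE.
move/le_trans; apply; rewrite le_eqVlt; apply/orP; left; apply/eqP.
congr (_ + _); congr (_ _ _); apply: inner_inj => a.
  by rewrite !(KE, KaE, LaE) !innerE; ring.
by rewrite /x' !(LE, KaE, LaE) !innerE; ring.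
Qed.

Definition saddle (z : X * U * V) : Prop :=
  [/\ adjoint K z.2 + adjoint L z.1.2 + c = 0,
    subdifferential f (K z.1.1) z.2 & subdifferential g (L z.1.1) z.1.2].

Lemma saddle_fixed z : saddle z -> pd_step z = z.
Proof.
case: z => [[x u] v] [/= KKT fv gu].
have KKT' : adjoint L u + adjoint K v + c = 0 by rewrite (addrC (adjoint L u)).
have vE : pd_dual_v (x, u, v) = v.
  rewrite /pd_dual_v /= KKT' scaler0 subr0.
  exact: prox_conjugate_unique.
have xE : pd_primal (x, u, v) = x.
  by rewrite /pd_primal vE /= KKT' scaler0 subr0.
rewrite /pd_step /pd_dual_u vE xE /= scaler_nat mulr2n addrK.
by rewrite prox_conjugate_unique.
Qed.

Lemma fixed_saddle z : pd_step z = z -> saddle z.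
Proof.
case: z => [[x u] v] [xE uE vE].
have [yf [pf fp]] := f_sub; have [yg [pg gp]] := g_sub.
have KKT : adjoint L u + adjoint K v + c = 0.
  move/eqP: xE; rewrite /pd_primal vE /= subr_eq addrC -subr_eq subrr eq_sym.
  by rewrite scaler_eq0 gt_eqF//= => /eqP.
split; rewrite /=.
- by rewrite (addrC (adjoint K v)).
- have := prox_conjugateP f_Gamma0
    (v + eta *: K (x - tau *: (adjoint L u + adjoint K v + c))) eta_gt0 fp.
  rewrite -[prox _ _]/(pd_dual_v (x, u, v)) /= vE KKT scaler0 subr0.
  by rewrite (addrC v) addrK scalerA mulVf ?gt_eqF// scale1r.
- have := prox_conjugateP g_Gamma0
    (u + sigma *: L (2 *: pd_primal (x, u, v) - x)) sigma_gt0 gp.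
  rewrite -[prox _ _]/(pd_dual_u (x, u, v)) /= uE xE scaler_nat mulr2n addrK.
  by rewrite (addrC u) addrK scalerA mulVf ?gt_eqF// scale1r.
Qed.

(** Add the subgradient inequalities of f at K x and of g at L x; by the first
    optimality condition the linear terms cancel <y - x, c>. *)
Lemma saddle_primal z : saddle z ->
  argmin [set: X] (fun y => f (K y) + g (L y) + (inner y c)%:E)%E z.1.1.
Proof.
case: z => [[x u] v] [/= KKT fv gu]; split=> // y _.
have [[_ pf _] [_ pg _]] := (f_Gamma0, g_Gamma0).
apply: le_trans (leeD2r _ (leeD (fv (K y)) (gu (L y)))).
rewrite -(fineK (subdifferential_fin_num pf fv)).
rewrite -(fineK (subdifferential_fin_num pg gu)) -!EFinD lee_fin.
have : inner (y - x) (adjoint K v + adjoint L u + c) = 0 by rewrite KKT inner0r.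
rewrite -!linearB !adjointP// !innerE; lra.
Qed.

(** K x and L x are subgradients of f^* at v and of g^* at u; on the constraint
    set the sum of the two linear terms vanishes. *)
Lemma saddle_dual z : saddle z ->
  argmin [set uv : U * V | adjoint K uv.2 + adjoint L uv.1 + c = 0]
    (fun uv => conjugate f uv.2 + conjugate g uv.1)%E (z.1.2, z.2).
Proof.
case: z => [[x u] v] [/= KKT fv gu]; split=> // -[u2 v2] /= KKT2.
have [[_ pf _] [_ pg _]] := (f_Gamma0, g_Gamma0).
have fv' := subdifferential_conjugate f_Gamma0 fv v2.
have gu' := subdifferential_conjugate g_Gamma0 gu u2.
apply: le_trans (leeD fv' gu').
rewrite (conjugate_subgradient f_Gamma0 fv) (conjugate_subgradient g_Gamma0 gu).
rewrite -(fineK (subdifferential_fin_num pf fv)).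
rewrite -(fineK (subdifferential_fin_num pg gu)) -!EFinB -!EFinD lee_fin.
have : inner x (adjoint K v2 + adjoint L u2 + c) = 0 by rewrite KKT2 inner0r.
have : inner x (adjoint K v + adjoint L u + c) = 0 by rewrite KKT inner0r.
rewrite !innerE -!adjointP// !(innerC v2) !(innerC v) !(innerC u2) !(innerC u).
lra.
Qed.

End PrimalDual.

(** * Convergence of the algorithm *)

Lemma weakly_converges_linear (R : realType) (E F : normedModType R)
    (A : E -> F) (C : R) (z : nat -> E) (l : E) :
  linear A -> (forall x, `|A x| <= C * `|x|) -> weakly_converges z l ->
  weakly_converges (A \o z) (A l).
Proof.
move=> A_linear A_bounded zl phi phi_cts.
have /linear_boundedP/pinfty_ex_gt0[D D0 HD] : bounded_near phi (nbhs (0 : F)).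
  by apply: continuous_linear_bounded; exact: phi_cts.
have [||psi psi_cts psiE] := @bounded_functional R E (phi \o A) (D * C).
- by move=> k x y /=; rewrite A_linear linearP.
- move=> x /=; apply: (le_trans (HD _)); rewrite -mulrA ler_pM2l//.
have := zl _ psi_cts; rewrite psiE /=.
by under eq_fun do rewrite psiE.
Qed.

Theorem theorem6p1 (R : realType) (X U V : hilbertType R)
    (f : V -> \bar R) (g : U -> \bar R) (c : X)
    (K : {linear X -> V}) (L : {linear X -> U})
    (f_Gamma0 : Gamma0 f) (g_Gamma0 : Gamma0 g)
    (K_bounded : bounded_near K (nbhs (0 : X)))
    (L_bounded : bounded_near L (nbhs (0 : X)))
    (K_neq0 : exists x, K x != 0) (L_neq0 : exists x, L x != 0)
    (qualification : exists x : X,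
      [set adjoint K p + adjoint L q + c |
        p in subdifferential f (K x) & q in subdifferential g (L x)] 0)
    (tau sigma eta : R)
    (tau_gt0 : 0 < tau) (sigma_gt0 : 0 < sigma) (eta_gt0 : 0 < eta)
    (tau_sigma_L : tau * sigma * opnorm L ^+ 2 < 1)
    (tau_eta_K : tau * eta * opnorm K ^+ 2 < 1)
    (rho : nat -> R) (rho_02 : forall i, 0 <= rho i <= 2)
    (rho_sum : (\sum_(0 <= i <oo) (rho i * (2 - rho i))%:E = +oo)%E)
    (x x' : nat -> X) (u u' : nat -> U) (v v' : nat -> V)
    (v'E : forall i, v' i =
      prox (fun y => (eta%:E * conjugate f y)%E)
        (v i + eta *: K (x i - tau *: (adjoint L (u i) + adjoint K (v i) + c))))
    (x'E : forall i, x' i =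
      x i - tau *: (adjoint L (u i) + adjoint K (v' i) + c))
    (u'E : forall i, u' i =
      prox (fun y => (sigma%:E * conjugate g y)%E)
        (u i + sigma *: L (2 *: x' i - x i)))
    (xS : forall i, x i.+1 = x i + rho i *: (x' i - x i))
    (uS : forall i, u i.+1 = u i + rho i *: (u' i - u i))
    (vS : forall i, v i.+1 = v i + rho i *: (v' i - v i)) :
  (exists2 xstar : X,
      argmin [set: X] (fun y => f (K y) + g (L y) + (inner y c)%:E)%E xstar &
      weakly_converges x xstar) /\
  (exists2 uvstar : U * V,
      argmin [set uv : U * V | adjoint K uv.2 + adjoint L uv.1 + c = 0]
        (fun uv => conjugate f uv.2 + conjugate g uv.1)%E uvstar &
      weakly_converges (fun i => (u i, v i)) uvstar).
Proof.
have [x0 [p fp [q gq KKT0]]] := qualification.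
pose step := pd_step f g c K L tau sigma eta.
pose z i : X * U * V := (x i, u i, v i).
have v'E' i : v' i = pd_dual_v f c K L tau eta (z i) by rewrite v'E.
have x'E' i : x' i = pd_primal f c K L tau eta (z i).
  by rewrite x'E v'E'.
have u'E' i : u' i = pd_dual_u f g c K L tau sigma eta (z i).
  by rewrite u'E x'E'.
have zS i : z i.+1 = z i + rho i *: (step (z i) - z i).
  by rewrite /z xS uS vS x'E' u'E' v'E'.
have f_sub : exists y s, subdifferential f y s by exists (K x0), p.
have g_sub : exists y s, subdifferential g y s by exists (L x0), q.
have HB := metric_equivalent K_bounded L_bounded tau_gt0 sigma_gt0 eta_gt0
  tau_sigma_L tau_eta_K.
have firm := pd_step_firm c f_Gamma0 g_Gamma0 K_bounded L_bounded
  tau_gt0 sigma_gt0 eta_gt0 f_sub g_sub.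
have saddle0 : saddle f g c K L (x0, q, p) by split.
have fixed0 := saddle_fixed f_Gamma0 g_Gamma0 tau sigma_gt0 eta_gt0 saddle0.
have compactE : weakly_ultracompact (X * U * V)%type.
  by do !apply: prod_weakly_ultracompact; exact: hilbert_weakly_ultracompact.
have [l lfix zl] :=
  Krasnoselskii_Mann HB firm rho_02 rho_sum zS fixed0 compactE.
have lsaddle := fixed_saddle f_Gamma0 g_Gamma0 tau_gt0 sigma_gt0 eta_gt0
  f_sub g_sub lfix.
split.
- exists l.1.1; first exact: saddle_primal lsaddle.
  apply: (@weakly_converges_linear _ _ _
    (fun w : X * U * V => w.1.1) 1 z) => //.
  by move=> w; rewrite mul1r; have [] := norm_component w.
- exists (l.1.2, l.2); first exact: saddle_dual lsaddle.
  apply: (@weakly_converges_linear _ _ _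
    (fun w : X * U * V => (w.1.2, w.2)) 1 z) => //.
  move=> w; rewrite mul1r prod_normE ge_max.
  by have [_ -> ->] := norm_component w.
Qed.
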